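(* Let $A=(Q,\hat q,\mathcal C,\mathcal T,\mathit{Inv})$ be a gTA with persistent guard locations ($\mathit{Inv}(q)=\top$ for every $q\in\mathit{Guards}(A)$), and let $\hat A$ be its summary automaton. Then for all $i\in\mathbb N$, $\mathcal L|_{[1,i]}(A^\infty)=\mathcal L\big((\mathrm{UG}(\hat A))^i\big)$.
   Context: Clocks and constraints: finite clock set; valuations into $\mathbb R_{\ge0}$; $\mathbf 0$ all-zero; clock constraints are $\top$ or conjunctions of atoms $c\sim c'+d$, $c\sim d$ ($d\in\mathbb N$, ${\sim}\in\{<,\le,=,\ge,>\}$). A gTA $A=(Q,\hat q,\mathcal C,\mathcal T,\mathit{Inv})$ has finite locations, initial $\hat q$, transitions $(q,g,r,\gamma,q')\in Q\times CC(\mathcal C)\times2^{\mathcal C}\times(Q\cup\{\top\})\times Q$ (clock guard $g$, resets $r$, location guard $\gamma$), invariants $\mathit{Inv}$. $\mathit{Guards}(A)$: location guards $\ne\top$ in $\mathcal T$. $\mathrm{UG}(A)$: the timed automaton obtained by replacing every location guard by $\top$, with standard semantics (delays allowed while the invariant holds; discrete transition if clock guard holds, resets applied, target invariant holds; stuttering transitions $(q,\top,\emptyset,\top,q)$ always available); timed paths alternate delay and discrete transitions; computations start at $(\hat q,\mathbf 0)$. Network $A^n$: $n$ copies, initial configuration $(\hat q,\mathbf 0)^n$; joint delays if all invariants hold throughout; a discrete step lets one process $i$ take a local transition with location guard $\gamma$, only if $\gamma=\top$ or another process is currently in location $\gamma$. $\mathcal L(A^n)$ is the set of computations. For $\pi\in\mathcal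 L(A^n)$ and $I\subseteq[1,n]$, $\pi|_I$ is its projection to processes in $I$ (discrete steps of others become stuttering steps of processes in $I$, for every possible such choice), $\mathcal L|_{[1,i]}(A^\infty)=\bigcup_{n\ge i}\{\pi|_{[1,i]}\mid\pi\in\mathcal L(A^n)\}$. $\mathrm{ReachLoc}(A^\infty)$: locations reachable in some $A^n$; $\delta^\infty_{\min}(q)$: minimal global time at which some process is in $q$ on a computation of some $A^n$ ($\infty$ if none; minima assumed attained, a standing assumption of the paper). Summary automaton: $\hat A=(Q,\hat q,\mathcal C\cup\{t\},\hat{\mathcal T},\mathit{Inv})$ with $t$ a fresh clock, where $(q,\hat g,r,\top,q')\in\hat{\mathcal T}$ iff there is $(q,g,r,\gamma,q')\in\mathcal T$ with either $\gamma=\top$ and $\hat g=g$, or $\gamma\in\mathrm{ReachLoc}(A^\infty)$ and $\hat g=g\wedge t\ge\delta^\infty_{\min}(\gamma)$. The clock $t$ is never reset (it measures global time); when comparing the two languages, the valuation of $t$ is disregarded.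
   Formalization: The equality is stated up to stuttering: the left-hand language is closed under merging a stuttering step (with its delay) into the next step or splitting one off, since literal equality fails when a hidden process must first move to a guard location. *)

(* Defs.v *)
From Stdlib Require Export List Relation_Operators.
From mathcomp Require Export all_boot all_order all_algebra.
From mathcomp Require Export all_classical all_reals ereal.

Set Implicit Arguments.
Unset Strict Implicit.
Unset Printing Implicit Defensive.

Import Order.TTheory GRing.Theory Num.Theory.
Local Open Scope classical_set_scope.
Local Open Scope ring_scope.

Inductive cmp := CLt | CLe | CEq | CGe | CGt.

Definition cmp_rel {R : realType} (o : cmp) (x y : R) : bool :=
  match o with
  | CLt => x < y | CLe => x <= y | CEq => x == y | CGe => y <= x | CGt => y < x
  end.

(* [Diag c o c' d] is c o c' + d, [Bound c o d] is c o d. The constants range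
   over R, so that the guards t >= delta of a summary automaton are
   constraints; for the automaton one starts from, d is required to be a
   natural number by [nat_constants]. *)
Inductive atom (R : realType) (C : Type) :=
| Diag of C & cmp & C & R
| Bound of C & cmp & R.
Arguments Diag {R C} _ _ _ _.
Arguments Bound {R C} _ _ _.

(* A conjunction of atoms; the empty list is the constraint Top. *)
Definition constraint (R : realType) (C : Type) := seq (atom R C).

Definition atom_const {R : realType} {C : Type} (a : atom R C) : R :=
  match a with Diag _ _ _ d => d | Bound _ _ d => d end.

Definition map_atom {R : realType} {C D : Type} (f : C -> D)
    (a : atom R C) : atom R D :=
  match a with
  | Diag c o c' d => Diag (f c) o (f c') d
  | Bound c o d => Bound (f c) o d
  end.

Definition valuation (R : realType) (C : finType) := {ffun C -> R}.

Definition sat_atom {R : realType} {C : finType} (v : valuation R C)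
    (a : atom R C) : bool :=
  match a with
  | Diag c o c' d => cmp_rel o (v c) (v c' + d)
  | Bound c o d => cmp_rel o (v c) d
  end.

Definition sat {R : realType} {C : finType} (v : valuation R C)
    (g : constraint R C) : bool := all (sat_atom v) g.

Definition val_delay {R : realType} {C : finType} (v : valuation R C) (d : R) :
    valuation R C := [ffun c => v c + d].

Definition val_reset {R : realType} {C : finType} (v : valuation R C)
    (r : {set C}) : valuation R C := [ffun c => if c \in r then 0 else v c].

(* [lguard = None] is the trivial location guard Top. *)
Record transition (R : realType) (Q C : finType) := Transition {
  src : Q;
  guard : constraint R C;
  resets : {set C};
  lguard : option Q;
  tgt : Q
}.

Record gTA (R : realType) (Q C : finType) := GTA {
  init : Q;
  trans : set (transition R Q C);
  trans_finite : finite_set trans;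
  inv : Q -> constraint R C
}.

Section Automata.
Context {R : realType} {Q C : finType}.
Implicit Types (A : gTA R Q C) (tau : transition R Q C).

Definition nat_constants A : Prop :=
  (forall tau, trans A tau ->
     all (fun a => atom_const a \is a Num.nat) (guard tau)) /\
  (forall q, all (fun a => atom_const a \is a Num.nat) (inv A q)).

Definition guard_locs A : set Q :=
  [set q | exists2 tau, trans A tau & lguard tau = Some q].

Definition persistent_guards A : Prop :=
  forall q, guard_locs A q -> inv A q = [::].

Definition drop_lguard tau : transition R Q C :=
  Transition (src tau) (guard tau) (resets tau) None (tgt tau).

Definition UG A : gTA R Q C :=
  GTA (init A) (finite_image drop_lguard (trans_finite A)) (inv A).

Definition stuttering (q : Q) : transition R Q C :=
  Transition q [::] finset.set0 None q.

Definition available A : set (transition R Q C) :=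
  trans A `|` range stuttering.

End Automata.

Definition config (R : realType) (Q C : finType) (n : nat) :=
  {ffun 'I_n -> Q * valuation R C}.

(* A delay [delay] followed by a discrete transition of process [proc] which
   resets [reset] and leads to [target]. Guards are not part of a step: those
   of an automaton and of its summary automaton differ. *)
Record step (R : realType) (Q C : finType) (n : nat) := Step {
  delay : R;
  proc : 'I_n;
  reset : {set C};
  target : config R Q C n
}.

Record tpath (R : realType) (Q C : finType) (n : nat) := TPath {
  start : config R Q C n;
  steps : seq (step R Q C n)
}.

Section Networks.
Context {R : realType} {Q C : finType}.
Implicit Types (A : gTA R Q C).

Definition init_config A (n : nat) : config R Q C n :=
  [ffun=> (init A, [ffun=> 0])].

Definition conf_delay {n} (c : config R Q C n) (d : R) : config R Q C n :=
  [ffun j => ((c j).1, val_delay (c j).2 d)].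

Definition can_delay A {n} (c : config R Q C n) (d : R) : Prop :=
  0 <= d /\
  forall d', 0 <= d' <= d ->
    forall j, sat (val_delay (c j).2 d') (inv A (c j).1).

Definition fire A {n} (c : config R Q C n) (j : 'I_n) (r : {set C})
    (c' : config R Q C n) : Prop :=
  exists tau, [/\ available A tau,
    src tau = (c j).1 /\ sat (c j).2 (guard tau),
    (if lguard tau is Some q
     then exists2 k, k != j & (c k).1 = q else True),
    r = resets tau /\
    c' = [ffun k => if k == j then (tgt tau, val_reset (c j).2 r) else c k]
  & sat (c' j).2 (inv A (tgt tau))].

Definition is_step A {n} (c : config R Q C n) (s : step R Q C n) : Prop :=
  can_delay A c (delay s) /\
  fire A (conf_delay c (delay s)) (proc s) (reset s) (target s).

Fixpoint run A {n} (c : config R Q C n) (ss : seq (step R Q C n)) : Prop :=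
  if ss is s :: ss' then is_step A c s /\ run A (target s) ss' else True.

Definition language A (n : nat) : set (tpath R Q C n) :=
  [set p | start p = init_config A n /\ run A (start p) (steps p)].
Arguments language A n _ : clear implicits.

Definition final {n} (p : tpath R Q C n) : config R Q C n :=
  last (start p) (map (@target R Q C n) (steps p)).

Definition duration {n} (p : tpath R Q C n) : R :=
  \sum_(s <- steps p) delay s.

(* Prefixes of computations are computations, so the final configurations of
   computations are all the configurations that occur on computations. *)
Definition occupied_at A (q : Q) : set R :=
  [set d | exists n (p : tpath R Q C n),
     [/\ language A n p, exists j, (final p j).1 = q & duration p = d]].

Definition reach_loc A : set Q := [set q | occupied_at A q !=set0].

(* +oo if q is not reachable. *)
Definition delta_min A (q : Q) : \bar R := ereal_inf (EFin @` occupied_at A q).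

Definition minima_attained A : Prop :=
  forall q, reach_loc A q -> (EFin @` occupied_at A q) (delta_min A q).

(* The clocks of the summary automaton are [option C], with fresh clock
   t = None. *)
Definition time_guard A (l : option Q) : constraint R (option C) :=
  if l is Some q then [:: Bound None CGe (fine (delta_min A q))] else [::].

Definition summary_trans A (tau : transition R Q C) :
    transition R Q (option C) :=
  Transition (src tau) (map (map_atom Some) (guard tau) ++
                        time_guard A (lguard tau))
    [set Some c | c in resets tau]%SET None (tgt tau).

Definition lguard_reachable A : set (transition R Q C) :=
  [set tau | if lguard tau is Some q then reach_loc A q else True].

Definition summary A : gTA R Q (option C) :=
  GTA (init A)
    (finite_image (summary_trans A)
       (finite_setIl (lguard_reachable A) (trans_finite A)))
    (fun q => map (map_atom Some) (inv A q)).

(* Projection to the processes f 0, ..., f (k - 1). A step of a process outside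
   the range of f becomes a stuttering step of an arbitrary process of the
   projection. *)
Definition conf_proj {k n} (f : 'I_k -> 'I_n) (c : config R Q C n) :
    config R Q C k := [ffun j => c (f j)].

Definition step_proj {k n} (f : 'I_k -> 'I_n) (s : step R Q C n)
    (s' : step R Q C k) : Prop :=
  [/\ delay s' = delay s, target s' = conf_proj f (target s) &
      (f (proc s') = proc s /\ reset s' = reset s) \/
      ((forall j, f j != proc s) /\ reset s' = finset.set0)].

Definition is_proj {k n} (f : 'I_k -> 'I_n) (p : tpath R Q C n)
    (p' : tpath R Q C k) : Prop :=
  start p' = conf_proj f (start p) /\
  Forall2 (step_proj f) (steps p) (steps p').

Definition proj_language A (i : nat) : set (tpath R Q C i) :=
  [set p' | exists n (le_in : (i <= n)%N) (p : tpath R Q C n),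
     language A n p /\ is_proj (widen_ord le_in) p p'].

(* [stutter_merge p p'] : p' is p with one stuttering step removed, the delay
   of which is added to that of the next step. *)
Inductive stutter_merge {n} : tpath R Q C n -> tpath R Q C n -> Prop :=
| StutterMerge c0 ss1 ss2 j d (s : step R Q C n) :
    0 <= d -> 0 <= delay s ->
    stutter_merge
      (TPath c0 (ss1 ++
         Step d j finset.set0 (conf_delay (final (TPath c0 ss1)) d) ::
         s :: ss2))
      (TPath c0 (ss1 ++
         Step (d + delay s) (proc s) (reset s) (target s) :: ss2)).

Definition stutter_equiv {n} : tpath R Q C n -> tpath R Q C n -> Prop :=
  clos_refl_sym_trans (tpath R Q C n) stutter_merge.

Definition up_to_stuttering {n} (L : set (tpath R Q C n)) :
    set (tpath R Q C n) :=
  [set p | exists2 p', L p' & stutter_equiv p' p].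

End Networks.

Arguments language {R Q C} A n _.
Arguments proj_language {R Q C} A i _.

Section ForgetClock.
Context {R : realType} {Q C : finType} {n : nat}.

Definition forget_conf (c : config R Q (option C) n) : config R Q C n :=
  [ffun j => ((c j).1, [ffun x => (c j).2 (Some x)])].

Definition forget_step (s : step R Q (option C) n) : step R Q C n :=
  Step (delay s) (proc s) [set x | Some x \in reset s]%SET
    (forget_conf (target s)).

Definition forget_clock (p : tpath R Q (option C) n) : tpath R Q C n :=
  TPath (forget_conf (start p)) (map forget_step (steps p)).

End ForgetClock.

(* Main.v *)
(** A step of the summary automaton guarded by [t >= delta q] has to be matched
    in the network by a process that has reached the guard location [q] in time
    [delta q]. Add one hidden helper process for each reachable guard location
    [q]; it performs the local path of the process that reaches [q] in a
    computation of duration [delta q] with as few steps as possible, and then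
    stays in [q] forever, which is possible because [q] has no invariant. The
    other processes of these computations are not copied: their invariants could
    block time later, and the guards that the helper uses are provided by other
    helpers. Indeed, if the helper bound for [q] uses the guard location [q'] at
    time [e], then [delta q' <= e], and [(delta q', length)] is
    lexicographically smaller than [(delta q, length)]. Hence the helpers never
    wait for one another in a circle if events are executed in the order of
    their time, then of this rank, and helpers move before visible processes. *)

Require Import Defs.
From mathcomp Require Import lra.
Import Order.TTheory GRing.Theory Num.Theory.
Local Open Scope classical_set_scope.
Local Open Scope ring_scope.
Set Implicit Arguments.
Unset Strict Implicit.
Unset Printing Implicit Defensive.

(** * Delays and runs of a network *)

Section Configurations.
Context {R : realType} {Q C : finType}.

Lemma val_delayD (v : valuation R C) (d e : R) :
  val_delay (val_delay v d) e = val_delay v (d + e).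
Proof. by apply/ffunP => c; rewrite !ffunE addrA. Qed.

Lemma conf_delayD n (c : config R Q C n) (d e : R) :
  conf_delay (conf_delay c d) e = conf_delay c (d + e).
Proof. by apply/ffunP => k; rewrite !ffunE /= val_delayD. Qed.

Lemma val_reset0 (v : valuation R C) : val_reset v finset.set0 = v.
Proof. by apply/ffunP => c; rewrite !ffunE finset.in_set0. Qed.

Lemma can_delay_inv (A : gTA R Q C) n (c : config R Q C n) d j :
  can_delay A c d -> sat (conf_delay c d j).2 (inv A (c j).1).
Proof. by case=> d0 /(_ d); rewrite d0 lexx ffunE => /(_ isT j). Qed.

Lemma can_delayD (A : gTA R Q C) n (c : config R Q C n) d e :
  0 <= d -> 0 <= e ->
  can_delay A c (d + e) <-> can_delay A c d /\ can_delay A (conf_delay c d) e.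
Proof.
move=> d0 e0; split=> [[_ de]|[[_ hd] [_ he]]].
  split; split=> // x /andP[x0 xd] j.
    by apply: de; rewrite x0 /=; lra.
  by rewrite ffunE /= val_delayD; apply: de; apply/andP; split; lra.
split=> [|x /andP[x0 xd] j]; first lra.
case: (leP x d) => [xled|dltx]; first by apply: hd; rewrite x0.
have := he (x - d); rewrite (_ : 0 <= x - d <= e); last by apply/andP; split; lra.
by move=> /(_ isT j); rewrite ffunE /= val_delayD addrC subrK.
Qed.

Lemma run_cat (A : gTA R Q C) n (c : config R Q C n) ss1 ss2 :
  run A c (ss1 ++ ss2) <->
  run A c ss1 /\ run A (final (TPath c ss1)) ss2.
Proof.
elim: ss1 c => [|s ss1 IH] c /=; first by split=> // -[].
rewrite IH /final /=; tauto.
Qed.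

Lemma final_rcons n (c : config R Q C n) ss s :
  final (TPath c (rcons ss s)) = target s.
Proof. by rewrite /final /= map_rcons last_rcons. Qed.

Lemma duration_rcons n (c : config R Q C n) ss s :
  duration (TPath c (rcons ss s)) = duration (TPath c ss) + delay s.
Proof. by rewrite /duration -cats1 big_cat big_seq1. Qed.

End Configurations.

(** * The summary automaton, with its clock t turned into a time parameter *)

Section Summary.
Context {R : realType} {Q C : finType}.
Variable A : gTA R Q C.

Definition loc_time (q : Q) : R := fine (delta_min A q).

(* The steps of [UG (summary A)], with the value of the clock t given by the
   parameter [T]. *)
Definition vfire (T : R) {n} (c : config R Q C n) (j : 'I_n) (r : {set C})
    (c' : config R Q C n) : Prop :=
  exists tau, [/\ available A tau,
    src tau = (c j).1 /\ sat (c j).2 (guard tau),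
    (if lguard tau is Some q then reach_loc A q /\ loc_time q <= T else True),
    r = resets tau /\
    c' = [ffun k => if k == j then (tgt tau, val_reset (c j).2 r) else c k]
  & sat (c' j).2 (inv A (tgt tau))].

Fixpoint vrun (T : R) {n} (c : config R Q C n) (ss : seq (step R Q C n)) : Prop :=
  if ss is s :: ss' then
    [/\ can_delay A c (delay s),
        vfire (T + delay s) (conf_delay c (delay s)) (proc s) (reset s) (target s)
      & vrun (T + delay s) (target s) ss']
  else True.

Definition timed_val (T : R) (v : valuation R C) : valuation R (option C) :=
  [ffun o => if o is Some x then v x else T].

(** The clock t starts at 0 in every process and is never reset, so all processes agree on it and
    one number [T] describes it. *)
Definition timed_conf (T : R) n (c : config R Q C n) :
    config R Q (option C) n := [ffun j => ((c j).1, timed_val T (c j).2)].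

Lemma forget_timed T n (c : config R Q C n) : forget_conf (timed_conf T c) = c.
Proof.
apply/ffunP => j; rewrite !ffunE /=; case: (c j) => q v /=.
by congr pair; apply/ffunP => x; rewrite !ffunE.
Qed.

Lemma timed_val_delay T (v : valuation R C) d :
  val_delay (timed_val T v) d = timed_val (T + d) (val_delay v d).
Proof. by apply/ffunP => -[x|]; rewrite !ffunE. Qed.

Lemma timed_conf_delay T n (c : config R Q C n) d :
  conf_delay (timed_conf T c) d = timed_conf (T + d) (conf_delay c d).
Proof. by apply/ffunP => j; rewrite !ffunE /= timed_val_delay. Qed.

Lemma sat_timed T (v : valuation R C) (g : constraint R C) :
  sat (timed_val T v) (map (map_atom Some) g) = sat v g.
Proof.
rewrite /sat all_map; apply: eq_all => -[c o c' d|c o d] /=; by rewrite !ffunE.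
Qed.

Lemma sat_time_guard T (v : valuation R C) l :
  sat (timed_val T v) (time_guard A l) =
  if l is Some q then loc_time q <= T else true.
Proof. by case: l => [q|] //=; rewrite ffunE andbT. Qed.

Lemma timed_can_delay T n (c : config R Q C n) d :
  can_delay (UG (summary A)) (timed_conf T c) d <-> can_delay A c d.
Proof.
have E x j : sat (val_delay (timed_conf T c j).2 x)
    (inv (UG (summary A)) (timed_conf T c j).1) =
  sat (val_delay (c j).2 x) (inv A (c j).1).
  by rewrite ffunE /= timed_val_delay sat_timed.
by split=> -[d0 H]; split=> // x /H {}H j; have := H j; rewrite E.
Qed.

Lemma timed_reset T v (r : {set C}) :
  val_reset (timed_val T v) [set Some c | c in r]%SET =
  timed_val T (val_reset v r).
Proof.
apply/ffunP => -[x|]; rewrite !ffunE; first by rewrite mem_imset // => ? ? [].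
by case: ifP => // /imsetP[].
Qed.

Lemma timed_update T n (c : config R Q C n) j q (r : {set C}) :
  [ffun k => if k == j then
       (q, val_reset (timed_conf T c j).2 [set Some c | c in r]%SET)
     else timed_conf T c k] =
  timed_conf T [ffun k => if k == j then (q, val_reset (c j).2 r) else c k].
Proof.
apply/ffunP => k; rewrite !ffunE /= timed_reset; by case: ifP.
Qed.

Lemma unimset_Some (r : {set C}) :
  [set x | Some x \in [set Some c | c in r]]%SET = r.
Proof. by apply/setP => x; rewrite inE mem_imset // => ? ? []. Qed.

Lemma timed_fire T n (c : config R Q C n) j r c' :
  fire (UG (summary A)) (timed_conf T c) j r c' <->
  exists r0 c0, [/\ vfire T c j r0 c0, r = [set Some c | c in r0]%SET
                  & c' = timed_conf T c0].
Proof.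
split.
- case=> tau [av [srcE g] _ [-> ->] I].
  (* Undoes the two images that form the transitions; stuttering comes from stuttering of [A]. *)
  have {av} [t0 [av tauE lr]] : exists t0, [/\ available A t0,
      tau = drop_lguard (summary_trans A t0)
    & lguard_reachable A t0].
    case: av => [[_ [t0 [t0A lr] <-] <-]|[q _ <-]].
      by exists t0; split=> //; left.
    exists (stuttering q); split=> //; first by right; exists q.
    by rewrite /stuttering /drop_lguard /summary_trans /= imset0.
  subst tau; move: srcE g I; rewrite /= timed_update !ffunE /= eqxx.
  rewrite /sat all_cat -!/(sat _ _) !sat_timed sat_time_guard.
  move=> srcE /andP[g tg] I.
  exists (resets t0), [ffun k => if k == j then
     (tgt t0, val_reset (c j).2 (resets t0)) else c k]; split=> //.
  exists t0; split=> //; last by rewrite ffunE eqxx.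
  by move: lr tg; rewrite /lguard_reachable /=; case: (lguard t0).
- case=> r0 [c0 [[t0 [av [srcE g] lg [-> ->]]]]].
  rewrite ffunE eqxx /= => I -> ->.
  exists (drop_lguard (summary_trans A t0)); split=> //=.
  + case: av => [av|[q _ <-]].
      left; exists (summary_trans A t0) => //; exists t0 => //; split=> //.
      by move: lg; rewrite /lguard_reachable /=; case: (lguard t0) => // q [].
    by right; exists q => //;
      rewrite /stuttering /drop_lguard /summary_trans /= imset0.
  + rewrite !ffunE /= /sat all_cat -!/(sat _ _) sat_timed sat_time_guard g.
    by split=> //; case: (lguard t0) lg => // q [].
  + by rewrite timed_update.
  + by rewrite !ffunE eqxx /= sat_timed.
Qed.

Lemma timed_run n (c : config R Q C n) T ss :
  vrun T c ss <->
  exists2 ss', run (UG (summary A)) (timed_conf T c) ss' &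
               map forget_step ss' = ss.
Proof.
split.
- elim: ss T c => [|[d j r c'] ss IH] T c /=; first by exists [::].
  case=> cd fi /IH[ss' ru E].
  exists (Step d j [set Some c | c in r]%SET (timed_conf (T + d) c') :: ss') => /=.
    split=> //; split=> /=; first exact/timed_can_delay.
    by rewrite timed_conf_delay; apply/timed_fire; exists r, c'.
  by rewrite E /forget_step /= forget_timed unimset_Some.
- case=> ss' ru <-; elim: ss' T c ru => [|[d j r c'] ss1 IH] T c //=.
  case=> -[/= /timed_can_delay cd].
  rewrite timed_conf_delay => /timed_fire[r0 [c0 [fi -> ->]]] /IH ru.
  by rewrite forget_timed unimset_Some.
Qed.

Lemma timed_init n : timed_conf 0 (init_config A n) = init_config (UG (summary A)) n.
Proof.
by apply/ffunP => j; rewrite !ffunE /=; congr pair; apply/ffunP => -[x|]; rewrite !ffunE.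
Qed.

(** Erasing t loses nothing: its value is the elapsed time, which the delays determine. *)
Lemma forget_languageE n (p : tpath R Q C n) :
  (forget_clock @` language (UG (summary A)) n) p <->
  start p = init_config A n /\ vrun 0 (start p) (steps p).
Proof.
split=> [[[c ss] [/= -> ru] <-]|].
  rewrite /= -timed_init forget_timed; split=> //.
  by apply/timed_run; exists ss; rewrite ?timed_init.
case: p => c ss [/= ->] /timed_run[ss' ru E].
exists (TPath (init_config (UG (summary A)) n) ss').
  by split; rewrite //= -timed_init.
by rewrite /forget_clock /= -timed_init forget_timed E.
Qed.

Lemma vrun_cat n T (c : config R Q C n) ss1 ss2 :
  vrun T c (ss1 ++ ss2) <->
  vrun T c ss1 /\
  vrun (T + duration (TPath c ss1)) (final (TPath c ss1)) ss2.
Proof.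
elim: ss1 T c => [|s ss1 IH] T c /=.
  by rewrite /duration /final /= big_nil addr0; split=> // -[].
rewrite /duration /final /= big_cons addrA.
split=> [[a b /IH[d e]]|[[a b d] e]]; first by split.
by split=> //; apply/IH; split.
Qed.

(** * Invariance of summary runs under stuttering *)

Lemma vfire_stuttering T n (c : config R Q C n) j :
  sat (c j).2 (inv A (c j).1) -> vfire T c j finset.set0 c.
Proof.
move=> I; exists (stuttering (c j).1); split=> //; first by right; exists (c j).1.
split=> //; apply/ffunP => k; rewrite ffunE val_reset0.
by case: eqP => // ->; case: (c j).
Qed.

(** Merging keeps the absolute time of all other steps, and stuttering is possible in the middle of
    a delay because the invariants hold throughout it. *)
Lemma vrun_stutter_merge n (p p' : tpath R Q C n) : stutter_merge p p' ->
  vrun 0 (start p) (steps p) <-> vrun 0 (start p') (steps p').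
Proof.
case=> c0 ss1 ss2 j d s d0 s0 /=.
rewrite !vrun_cat /= !addrA !conf_delayD.
set c := final _; set T := 0 + _.
split=> -[ru1]; [case=> cd _ [cd' fi ru]|case=> cd fi ru]; split=> //.
  by split=> //; apply/can_delayD.
move/can_delayD: (cd) => /(_ d0 s0)[cd1 cd2].
split=> //; apply: vfire_stuttering.
have := can_delay_inv j cd1; by rewrite !ffunE.
Qed.

Lemma stutter_equiv_start n (p p' : tpath R Q C n) :
  stutter_equiv p p' -> start p = start p'.
Proof. by elim=> [_ _ []|//|? ? _ -> //|? ? ? _ -> _ ->]. Qed.

Lemma vrun_stutter_equiv n (p p' : tpath R Q C n) : stutter_equiv p p' ->
  vrun 0 (start p) (steps p) <-> vrun 0 (start p') (steps p').
Proof.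
by elim=> [? ? /vrun_stutter_merge|//|? ? _ ->|? ? ? _ -> _ ->].
Qed.

(** [StutterMerge] computes the target of the removed step from the start of the path, so a step put
    in front has to end in [start p]. *)
Lemma stutter_equiv_cons n (p p' : tpath R Q C n) c0 s :
  stutter_equiv p p' -> start p = target s ->
  stutter_equiv (TPath c0 (s :: steps p)) (TPath c0 (s :: steps p')).
Proof.
elim=> {p p'} [p p' []|p|p p' pp IH|x y z xy IH1 yz IH2] E; last 1 first.
- by apply: rst_trans (IH1 E) (IH2 _); rewrite -(stutter_equiv_start xy).
- move=> ss1 ss2 j d s' d0 s0 /= Ec; subst E; apply: rst_step.
  exact: (StutterMerge c0 (s :: ss1) ss2 j d0 s0).
- exact: rst_refl.
- by apply: rst_sym; apply: IH; rewrite (stutter_equiv_start pp).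
Qed.

End Summary.

(** * Network computations, their projections and their minimal times *)

Section Computations.
Context {R : realType} {Q C : finType}.
Variable A : gTA R Q C.
Hypothesis A_min : minima_attained A.

Lemma reach_final n (p : tpath R Q C n) j :
  language A n p -> reach_loc A (final p j).1.
Proof. by move=> pA; exists (duration p), n, p; split=> //; exists j. Qed.

(** The minimum is attained, hence a real number, and [fine] does not return its default value. *)
Lemma delta_minE q : reach_loc A q ->
  delta_min A q = (loc_time A q)%:E /\ occupied_at A q (loc_time A q).
Proof. by rewrite /loc_time => /A_min[d dq <-]. Qed.

Lemma loc_time_le n (p : tpath R Q C n) j :
  language A n p -> loc_time A (final p j).1 <= duration p.
Proof.
move=> pA; have [E _] := delta_minE (reach_final j pA).
rewrite -lee_fin -E; apply: ereal_inf_lbound.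
by exists (duration p) => //; exists n, p; split=> //; exists j.
Qed.

Lemma run_duration_ge0 n (c : config R Q C n) ss :
  run A c ss -> 0 <= duration (TPath c ss).
Proof.
rewrite /duration /=; elim: ss c => [|s ss IH] c; first by rewrite big_nil.
by rewrite big_cons => -[[[d0 _] _] /IH]; apply: addr_ge0.
Qed.

(** A location that a guard finds occupied is reachable, and its minimal time is at most the present
    time. The prefix [pre] is kept so that the current configuration ends a computation, to which
    [loc_time_le] applies. *)
Lemma vrun_proj k n (f : 'I_k -> 'I_n) (pre ss : seq (step R Q C n)) ssv :
  injective f -> run A (init_config A n) (pre ++ ss) ->
  Forall2 (step_proj f) ss ssv ->
  vrun A (duration (TPath (init_config A n) pre))
       (conf_proj f (final (TPath (init_config A n) pre))) ssv.
Proof.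
move=> f_inj; set c0 := init_config A n.
elim: ss pre ssv => [|s ss IH] pre ssv ru pr; inversion pr; subst => //.
rename y into s', l' into ssv', H1 into ps, H3 into pr'.
have := ru; rewrite run_cat => -[run_pre [[cd fi] _]].
move: cd fi; rewrite -/c0.
have lang_pre : language A n (TPath c0 pre) by split.
set c := final (TPath c0 pre) => cd fi.
case: ps => dE tE pE /=.
have confE d : conf_delay (conf_proj f c) d = conf_proj f (conf_delay c d).
  by apply/ffunP => j; rewrite !ffunE.
rewrite dE tE; split.
- case: cd => d0 cd; split=> // d' /cd cd' j; by rewrite ffunE; apply: cd'.
- case: pE => [[pE rE]|[pN rE]].
    case: fi => tau [av [srcE g] lg [r_E t_E] I]; exists tau.
    rewrite confE; split=> //.
    + by rewrite [conf_proj _ _ _]ffunE pE.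
    + case: (lguard tau) lg => // q [k0 _ <-]; rewrite ffunE /=.
      split; first exact: (reach_final k0 lang_pre).
      rewrite (le_trans (loc_time_le k0 lang_pre)) // lerDl; by case: cd.
    + split; first by rewrite rE.
      apply/ffunP => j; rewrite t_E rE !ffunE -pE (inj_eq f_inj); by case: eqP.
    + by rewrite ffunE pE.
  (* The moving process is hidden: the visible ones only let time pass. *)
  case: fi => tau [_ _ _ [_ t_E] _].
  have -> : conf_proj f (target s) = conf_delay (conf_proj f c) (delay s).
    rewrite confE t_E; apply/ffunP => j; rewrite !ffunE.
    by rewrite (negbTE (pN j)).
  rewrite rE; apply: vfire_stuttering; rewrite confE ffunE.
  by have := can_delay_inv (f (proc s')) cd; rewrite ffunE.
- rewrite -duration_rcons -(final_rcons c0 pre s).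
  by apply: IH => //; rewrite cat_rcons.
Qed.

Lemma proj_language_vrun i (p : tpath R Q C i) : proj_language A i p ->
  start p = init_config A i /\ vrun A 0 (start p) (steps p).
Proof.
move=> [n [le_in [[c ss] [[/= -> ru] [/= stE pr]]]]].
have E : start p = init_config A i.
  by rewrite stE; apply/ffunP => j; rewrite !ffunE.
split=> //; have inj : injective (widen_ord le_in).
  by move=> a b /(congr1 val) /= /val_inj.
have := vrun_proj (pre := [::]) inj ru pr.
by rewrite /duration big_nil -stE.
Qed.

Definition reached_in (q : Q) (k : nat) : Prop :=
  exists n (p : tpath R Q C n) j, [/\ language A n p, (final p j).1 = q,
    duration p = loc_time A q & size (steps p) = k].

(** Length is minimised only among computations of minimal duration; well-ordering of the naturals
    gives the minimum. *)
Lemma shortest_computations : exists len : Q -> nat, forall q, reach_loc A q ->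
  reached_in q (len q) /\ forall k, reached_in q k -> (len q <= k)%N.
Proof.
suff /choice[len lenP] : forall q, exists k, reach_loc A q ->
    reached_in q k /\ forall k', reached_in q k' -> (k <= k')%N by exists len.
move=> q.
case: (pselect (reach_loc A q)) => [qA|qNA]; last by exists 0%N.
have [_ [n [p [pA [j pj] dE]]]] := delta_minE qA.
have ex : exists k, `[< reached_in q k >].
  by exists (size (steps p)); apply/asboolP; exists n, p, j.
exists (ex_minn ex) => _; case: ex_minnP => k /asboolP kP kmin; split=> // k' k'P.
by apply: kmin; apply/asboolP.
Qed.

End Computations.

(** * Local paths of the helpers *)

Section Helpers.
Context {R : realType} {Q C : finType}.
Variable A : gTA R Q C.
Hypothesis A_min : minima_attained A.
Variable len : Q -> nat.
Hypothesis lenP : forall q, reach_loc A q ->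
  reached_in A q (len q) /\ forall k, reached_in A q k -> (len q <= k)%N.

(* Rules out circular waiting between helpers that have to arrive at the same
   time. *)
Definition rank (q : Q) : (R *l nat)%type := (loc_time A q, len q).

(* [x] is the local state at time [T] of a process bound for [g]; the events
   are its remaining transitions with their absolute times. *)
Fixpoint hpath (g : Q) (T : R) (x : Q * valuation R C)
    (l : seq (R * transition R Q C)) : Prop :=
  if l is (e, tau) :: l' then
    let v := val_delay x.2 (e - T) in
    let v' := val_reset v (resets tau) in
    [/\ (T <= e <= loc_time A g) /\
        (forall d, 0 <= d <= e - T -> sat (val_delay x.2 d) (inv A x.1)),
        [/\ available A tau, src tau = x.1 & sat v (guard tau)],
        (if lguard tau is Some q then
           [/\ reach_loc A q, loc_time A q <= e & (rank q < rank g)%O]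
         else True),
        sat v' (inv A (tgt tau))
      & hpath g e (tgt tau, v') l']
  else x.1 = g.

(** The events are those of process [j], with stuttering wherever another process moves. A guard
    location used after [pre] is already occupied at the end of [pre], which bounds its rank. *)
Lemma computation_hpath n (pre ss : seq (step R Q C n)) j g :
  run A (init_config A n) (pre ++ ss) ->
  (final (TPath (init_config A n) (pre ++ ss)) j).1 = g ->
  duration (TPath (init_config A n) (pre ++ ss)) = loc_time A g ->
  size (pre ++ ss) = len g ->
  exists l, hpath g (duration (TPath (init_config A n) pre))
    (final (TPath (init_config A n) pre) j) l.
Proof.
set c0 := init_config A n.
elim: ss pre => [|s ss IH] pre ru fE dE sE.
  by exists [::]; rewrite /= -fE cats0.
have [] := IH (rcons pre s); rewrite ?cat_rcons // => l.
rewrite final_rcons duration_rcons => hp.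
move: (ru); rewrite run_cat; set T := duration (TPath c0 pre) in hp *.
set c := final (TPath c0 pre) => -[run_pre [[cd fi] run_post]].
have lang_pre : language A n (TPath c0 pre) by split.
have d0 : 0 <= delay s by case: cd.
have eT : T + delay s <= loc_time A g.
  rewrite -dE /T /duration /= big_cat big_cons /= lerD2l lerDl.
  exact: (run_duration_ge0 run_post).
have eTE : T + delay s - T = delay s by rewrite addrAC subrr add0r.
suff [tau [av [srcE gu] lg I tE]] : exists tau, [/\ available A tau,
    src tau = (c j).1 /\ sat (val_delay (c j).2 (delay s)) (guard tau),
    (if lguard tau is Some q then exists k, (c k).1 = q else True),
    sat (val_reset (val_delay (c j).2 (delay s)) (resets tau)) (inv A (tgt tau))
  & target s j = (tgt tau, val_reset (val_delay (c j).2 (delay s)) (resets tau))].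
  exists ((T + delay s, tau) :: l); rewrite /= eTE -tE; split=> //.
  - split; first by rewrite eT lerDl d0.
    by move=> d dd; apply: (cd.2 d dd j).
  - case: (lguard tau) lg => // q [k kE].
    have qT : loc_time A q <= T by rewrite -kE; apply: loc_time_le.
    have qA : reach_loc A q by rewrite -kE; apply: (reach_final k lang_pre).
    split=> //; first by rewrite (le_trans qT) // lerDl.
    have Tg : T <= loc_time A g by apply: le_trans eT; rewrite lerDl.
    rewrite /rank ltxi_pair (le_trans qT Tg) /=; apply/implyP => gq.
    (* With equal minimal times, [pre] itself reaches [q] in minimal time, and it is shorter than
       the whole computation. *)
    apply: (@leq_ltn_trans (size pre)).
      apply: (lenP qA).2; exists n, (TPath c0 pre), k; split=> //.
      apply/eqP; rewrite eq_le qT andbT; exact: le_trans gq.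
    by rewrite -sE size_cat /= addnS ltnS leq_addr.
case: fi => tau [av [srcE gu] lg [rE tE] I].
case: (eqVneq j (proc s)) => [jE|jN].
  exists tau; move: I srcE gu; rewrite tE rE !ffunE /= jE eqxx /= => I srcE gu.
  split=> //; case: (lguard tau) lg => // q [k _]; rewrite ffunE /= => <-.
  by exists k.
(* Another process moves, so the event of [j] is a stuttering transition. *)
exists (stuttering (c j).1); split=> //=.
- by right; exists (c j).1.
- rewrite val_reset0; by have := can_delay_inv j cd; rewrite ffunE.
- by rewrite tE !ffunE (negbTE jN) val_reset0.
Qed.

Lemma init_hpath q : reach_loc A q ->
  exists l, hpath q 0 (init A, [ffun=> 0]) l.
Proof.
move=> qA; have [[n [[c ss] [j [[/= -> ru] fE dE sE]]]] _] := lenP qA.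
have [l] := computation_hpath (pre := [::]) ru fE dE sE.
by rewrite /duration /final big_nil /= ffunE; exists l.
Qed.

(** The default 0 never acts as a time: comparisons are made only for nonempty lists. *)
Definition next_time (l : seq (R * transition R Q C)) : R := head 0 (map fst l).

(** Up to the next event the path itself guarantees the invariant; a finished path rests in [g],
    where nothing limits time. *)
Lemma hpath_delay g T x l d : inv A g = [::] -> 0 <= d ->
  (l <> [::] -> T + d <= next_time l) -> hpath g T x l ->
  (forall d', 0 <= d' <= d -> sat (val_delay x.2 d') (inv A x.1)) /\
  hpath g (T + d) (x.1, val_delay x.2 d) l.
Proof.
move=> g0 d0; case: l => [_ /= ->|[e tau] l /=].
  by rewrite g0.
move=> /(_ ltac:(by [])); rewrite /next_time /= => Tde [[/andP[Te eg] I] av lg tI hp].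
split=> [d' /andP[d'0 d'd]|]; first by apply: I; rewrite d'0 /=; lra.
rewrite val_delayD; have -> : d + (e - (T + d)) = e - T by lra.
split=> //; split=> [|d' /andP[d'0 d'd]]; first by rewrite Tde.
rewrite val_delayD; apply: I; apply/andP; split; lra.
Qed.

(** * Visible processes and helpers side by side *)

Definition cjoin i m (c : config R Q C i) (h : config R Q C m) :
    config R Q C (i + m) :=
  [ffun k : 'I_(i + m) => match fintype.split k with inl a => c a | inr b => h b end].

Lemma cjoinl i m (c : config R Q C i) (h : config R Q C m) a :
  cjoin c h (lshift m a) = c a.
Proof. by rewrite ffunE (unsplitK (inl a)). Qed.

Lemma cjoinr i m (c : config R Q C i) (h : config R Q C m) b :
  cjoin c h (rshift i b) = h b.
Proof. by rewrite ffunE (unsplitK (inr b)). Qed.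

Lemma cjoin_delay i m (c : config R Q C i) (h : config R Q C m) d :
  conf_delay (cjoin c h) d = cjoin (conf_delay c d) (conf_delay h d).
Proof.
apply/ffunP => k; rewrite !ffunE; by case: fintype.split => x; rewrite ffunE.
Qed.

Lemma cjoin_can_delay i m (c : config R Q C i) (h : config R Q C m) d :
  can_delay A c d -> can_delay A h d -> can_delay A (cjoin c h) d.
Proof.
move=> [d0 cd] [_ hd]; split=> // d' dd' k; rewrite ffunE.
by case: fintype.split => x; [apply: cd|apply: hd].
Qed.

Lemma conf_proj_cjoin i m (c : config R Q C i) (h : config R Q C m) :
  conf_proj (lshift m) (cjoin c h) = c.
Proof. by apply/ffunP => a; rewrite ffunE cjoinl. Qed.

(** * Simulation of a summary run with helpers *)

Section Simulation.
Variables (i m : nat) (loc : 'I_m -> Q).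
Hypothesis loc_inv : forall b, inv A (loc b) = [::].
Hypothesis loc_surj :
  forall q, guard_locs A q -> reach_loc A q -> exists b, loc b = q.
Implicit Types (c : config R Q C i) (h : config R Q C m)
  (l : 'I_m -> seq (R * transition R Q C)).

Definition helpers T h l := forall b, hpath (loc b) T (h b) (l b).

Lemma available_guard tau q :
  available A tau -> lguard tau = Some q -> guard_locs A q.
Proof. by case=> [tA lE|[? _ <-] //]; exists tau. Qed.

Lemma helpers_delay T h l d : helpers T h l -> 0 <= d ->
  (forall b, l b <> [::] -> T + d <= next_time (l b)) ->
  can_delay A h d /\ helpers (T + d) (conf_delay h d) l.
Proof.
move=> hl d0 nt; split=> [|b]; first split=> // d' dd' b.
  by have [I _] := hpath_delay (loc_inv b) d0 (nt b) (hl b); apply: I.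
by have [_] := hpath_delay (loc_inv b) d0 (nt b) (hl b); rewrite ffunE.
Qed.

Definition priority l b : (R *l (R *l nat))%type :=
  (next_time (l b), rank (loc b)).

Definition first_helper l b : Prop := l b <> [::] /\
  forall b', l b' <> [::] -> (priority l b <= priority l b')%O.

Lemma exists_first_helper l b : l b <> [::] -> exists b0, first_helper l b0.
Proof.
move=> lb; have Plb : `[< l b <> [::] >] by apply/asboolP.
case: (Order.TotalTheory.arg_minP (P := fun b => `[< l b <> [::] >])
  (priority l) Plb) => b0 /asboolP b0P minb0.
by exists b0; split=> // b' /asboolP /minb0.
Qed.

(** Serves the most urgent helper event within the visible delay [d]; the decreasing sum drives the
    induction in [vrun_simulated]. *)
Lemma first_helper_step T c h l b d : helpers T h l -> can_delay A c d ->
  first_helper l b -> next_time (l b) <= T + d ->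
  exists e r h' l', [/\ T <= e <= T + d, helpers e h' l',
    (\sum_b size (l' b) < \sum_b size (l b))%N
  & is_step A (cjoin c h)
      (Step (e - T) (rshift i b) r (cjoin (conf_delay c (e - T)) h'))].
Proof.
move=> hl cd [lb min_b]; move: (hl b); case lE : (l b) lb => [|[e tau] l0] // _.
rewrite /next_time /= => -[[/andP[Te eg] I] [av srcE gu] lg tI hp] eTd.
have next_ge b' : l b' <> [::] -> e <= next_time (l b').
  by move=> /min_b; rewrite /priority lE lexi_pair => /andP[].
have eTE : T + (e - T) = e by rewrite addrC subrK.
have eT0 : 0 <= e - T by rewrite subr_ge0.
have := helpers_delay hl eT0; rewrite eTE => /(_ next_ge)[cdh hl'].
pose x := (tgt tau, val_reset (val_delay (h b).2 (e - T)) (resets tau)).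
exists e, (resets tau),
  [ffun b' => if b' == b then x else conf_delay h (e - T) b'],
  (fun b' => if b' == b then l0 else l b'); split.
- by rewrite Te.
- by move=> b'; rewrite ffunE; case: eqP => [->|_].
- rewrite (bigD1 b) //= [ltnRHS](bigD1 b) //= eqxx lE /= addSn ltnS leq_add2l.
  by apply/leq_sum => b' /negbTE ->.
split=> /=.
  apply: cjoin_can_delay => //.
  have : can_delay A c (e - T + (d - (e - T))) by rewrite addrC subrK.
  by move/can_delayD => [] //; lra.
rewrite cjoin_delay; exists tau; rewrite !cjoinr !ffunE eqxx; split=> //.
- case lgE : (lguard tau) lg => [q|] // [qA qe rk].
  have [b' b'q] := loc_surj (available_guard av lgE) qA.
  (* An event left to [b'] would come no later than [loc_time A q <= e], so at time [e] by
     minimality, and would then precede that of [b] by rank. *)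
  have lb' : l b' = [::].
    case lE' : (l b') => [|[e' tau'] l0'] //.
    have := min_b b'; rewrite /priority lE' lE /next_time /= => /(_ ltac:(by [])).
    rewrite lexi_pair => /andP[ee']; have := hl b'; rewrite lE' /= b'q.
    case=> -[/andP[_ e'q] _] _ _ _ _; rewrite (le_trans e'q qe) /=.
    by rewrite leNgt rk.
  exists (rshift i b'); last first.
    by rewrite cjoinr ffunE /=; have := hl b'; rewrite lb' b'q.
  (* [b'] differs from [b], which still has an event. *)
  rewrite eq_rshift; apply/eqP => b'b; by rewrite -b'b lb' in lE.
- split=> //; apply/ffunP => k; rewrite [RHS]ffunE.
  case: (split_ordP k) => a ->; rewrite ?cjoinl ?cjoinr ?eq_lrshift ?eq_rshift //.
  by rewrite ffunE.
Qed.

(** The helper bound for a guard location [q] has no event after [loc_time A q <= T]; as all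
    remaining events are later than [T], it already rests in [q]. *)
Lemma vfire_cjoin T c h l j r c' : helpers T h l ->
  (forall b, l b <> [::] -> T < next_time (l b)) ->
  vfire A T c j r c' -> fire A (cjoin c h) (lshift m j) r (cjoin c' h).
Proof.
move=> hl late [tau [av [srcE gu] lg [-> ->] I]]; exists tau.
rewrite !cjoinl; split=> //.
- case lgE : (lguard tau) lg => [q|] // [qA qT].
  have [b bq] := loc_surj (available_guard av lgE) qA.
  exists (rshift i b); first by rewrite eq_rlshift.
  rewrite cjoinr; move: (hl b) (late b); case: (l b) => [|[e tau'] l0]; rewrite /= bq //.
  case=> -[/andP[_ eq] _] _ _ _ _ /(_ ltac:(by [])).
  by rewrite /next_time /= ltNge (le_trans eq qT).
- split=> //; apply/ffunP => k; rewrite [RHS]ffunE.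
  case: (split_ordP k) => a ->; rewrite ?cjoinl ?cjoinr ?eq_rlshift ?eq_lshift //.
  by rewrite ffunE.
Qed.

Lemma vrun_simulated T c h l ss : helpers T h l -> vrun A T c ss ->
  exists ssn ssv, [/\ run A (cjoin c h) ssn,
    Forall2 (step_proj (lshift m)) ssn ssv
  & stutter_equiv (TPath c ssv) (TPath c ss)].
Proof.
elim: ss T c h l => [|s ss IHss] T c h l hl.
  by exists [::], [::]; split=> //; apply: rst_refl.
(* Inner induction on the number of remaining helper events: serving one splits the delay of [s] and
   leaves the rest of the visible path alone. *)
have [N] := ubnP (\sum_b size (l b)); elim: N s T c h l hl => // N IHN s T c h l hl.
rewrite ltnS => sN vr; have [cd fi ru] := vr; have [d0 _] := cd.
(* Not strict: helper events simultaneous with [s] go first, so that a guard met exactly at its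
   minimal time finds its location occupied. *)
case: (pselect (exists b, l b <> [::] /\ next_time (l b) <= T + delay s)).
- case=> b [lb bT]; have [b0 first_b0] := exists_first_helper lb.
  have b0T : next_time (l b0) <= T + delay s.
    apply: le_trans bT; have := first_b0.2 b lb.
    by rewrite /priority lexi_pair => /andP[].
  have [e [r [h' [l' [/andP[Te eTd] hl' lt_l' st]]]]] :=
    first_helper_step hl cd first_b0 b0T.
  have e0 : 0 <= e - T by rewrite subr_ge0.
  have f0 : 0 <= delay s - (e - T) by lra.
  have dE : e - T + (delay s - (e - T)) = delay s by lra.
  have eE : e + (delay s - (e - T)) = T + delay s by lra.
  pose s' := Step (delay s - (e - T)) (proc s) (reset s) (target s).
  have vr' : vrun A e (conf_delay c (e - T)) (s' :: ss).
    move: cd; rewrite -{1}dE => /(can_delayD _ _ e0 f0)[_ cd'].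
    by split; rewrite //= ?eE // conf_delayD dE.
  have [ssn [ssv [run_n pr eqv]]] := IHN s' e _ h' l' hl' (leq_trans lt_l' sN) vr'.
  (* The helper step projects to stuttering of some visible process; [proc s] is at hand. *)
  exists (Step (e - T) (rshift i b0) r (cjoin (conf_delay c (e - T)) h') :: ssn),
    (Step (e - T) (proc s) finset.set0 (conf_delay c (e - T)) :: ssv).
  split=> //.
    apply: Forall2_cons => //; split; rewrite //= ?conf_proj_cjoin //.
    by right; split=> // j; rewrite eq_lrshift.
  (* Merging this stuttering step with [s'] restores [s]. *)
  apply: rst_trans; first exact: (stutter_equiv_cons c eqv).
  apply: rst_step; have := StutterMerge c [::] ss (proc s) e0 (s := s') f0.
  by rewrite /= dE; case: (s).
- move=> none.
  have late b : l b <> [::] -> T + delay s < next_time (l b).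
    by move=> lb; rewrite ltNge; apply/negP => lbT; apply: none; exists b.
  have [cdh hl'] := helpers_delay hl d0 (fun b lb => ltW (late b lb)).
  have [ssn [ssv [run_n pr eqv]]] := IHss _ _ _ _ hl' ru.
  exists (Step (delay s) (lshift m (proc s)) (reset s)
            (cjoin (target s) (conf_delay h (delay s))) :: ssn), (s :: ssv).
  split=> //.
  + split=> //; split=> /=; first exact: cjoin_can_delay.
    by rewrite cjoin_delay; apply: vfire_cjoin fi.
  + apply: Forall2_cons => //; split; rewrite //= ?conf_proj_cjoin //.
    by left.
  + exact: (stutter_equiv_cons c eqv).
Qed.

End Simulation.
End Helpers.

(* [up_to_stuttering] is needed on the left: a step of a hidden process, e.g.
   of one moving to a guard location, is visible in a projection as a
   stuttering step, while the summary automaton need not stutter there. *)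
Theorem theorem2 (R : realType) (Q C : finType) (A : gTA R Q C)
    (A_nat : nat_constants A)
    (A_min : minima_attained A)
    (A_pers : persistent_guards A)
    (i : nat) :
  up_to_stuttering (proj_language A i) =
  forget_clock @` language (UG (summary A)) i.
Proof.
apply/seteqP; split=> [p [p' /(proj_language_vrun A_min)[p'E vr] eqv]|p].
  apply/forget_languageE; rewrite -(stutter_equiv_start eqv).
  split=> //; rewrite (stutter_equiv_start eqv).
  exact: (vrun_stutter_equiv A eqv).1.
case/forget_languageE => pE vr.
have [len lenP] := shortest_computations A_min.
(* One helper for each reachable guard location; persistence removes the invariants there. *)
pose G := [set q : Q | `[< guard_locs A q /\ reach_loc A q >]]%SET.
pose loc (b : 'I_#|G|) : Q := enum_val b.
have locP b : guard_locs A (loc b) /\ reach_loc A (loc b).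
  have := enum_valP b; by rewrite finset.inE => /asboolP.
have loc_inv b : inv A (loc b) = [::] by apply: A_pers; case: (locP b).
have loc_surj q : guard_locs A q -> reach_loc A q -> exists b, loc b = q.
  move=> qG qA; have qG' : q \in G by rewrite finset.inE; apply/asboolP.
  by exists (enum_rank_in qG' q); rewrite /loc enum_rankK_in.
have [l hl] : exists l, helpers A len loc 0 (init_config A #|G|) l.
  suff /choice[l lP] : forall b, exists l,
      hpath A len (loc b) 0 (init_config A #|G| b) l by exists l.
  by move=> b; rewrite ffunE; apply: (init_hpath A_min lenP); case: (locP b).
have [ssn [ssv [run_n pr eqv]]] := vrun_simulated loc_inv loc_surj hl vr.
exists (TPath (start p) ssv); last by case: p eqv {pE vr run_n}.
(* The visible processes come first, so the projection to the first [i] is [lshift]. *)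
exists (i + #|G|)%N, (leq_addr _ _), (TPath (cjoin (start p) (init_config A #|G|)) ssn).
have wE : widen_ord (leq_addr #|G| i) = lshift #|G|.
  by apply/funext => a; apply: val_inj.
split; last by split; rewrite wE //= conf_proj_cjoin.
split=> //=; rewrite pE; apply/ffunP => k; rewrite !ffunE.
by case: fintype.split => a; rewrite ffunE.
Qed.
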